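(* Consider the plant $\dot x=Ax+Bu+Ep(q)+E_ww$, $y=Cx$, $q=C_qx$ (i.e. $D=\mathbf 0$, $F_w=\mathbf 0$), where $p$ is globally Lipschitz continuous and the disturbance satisfies $\|w\|_\infty\le\omega_0$ for an arbitrary given $\omega_0>0$. Suppose there exist $\alpha_0>0$, $\mu>0$, a symmetric $P>0$ in $\mathbb{R}^{2n_x\times2n_x}$ and matrices $K_1,K_2,L_1,L_2$ such that, for the continuous-time closed-loop system formed by the plant, the observer $\dot{\hat x}=A\hat x+Bu+Ep(\hat q+L_1(\hat y-y))+L_2(\hat y-y)$, $\hat y=C\hat x$, $\hat q=C_q\hat x$, and the controller $u=K_1\hat x+K_2p(C_q\hat x)$, the function $V(z)=z^\top Pz$ with $z=(x^\top,(x-\hat x)^\top)^\top$ satisfies $\dot V\le-\alpha_0V$ along its trajectories when $w\equiv0$. Now consider the implementation with two asynchronous event-triggering mechanisms: output sampling times $t_0^y=0<t_1^y<\cdots$ with $y_s(t)=y(t_k^y)$ for $t\in[t_k^y,t_{k+1}^y)$ and $t_{k+1}^y=\inf\{t\mid t\ge t_k^y+\tau_y,\ \|y_s(t)-y(t)\|>\sigma_y\|y(t)\|+\epsilon_y\}$; observer $\dot{\hat x}=A\hat x+Bu+Ep(\hat q+L_1(\hat y-y_s))+L_2(\hat y-y_s)$, $\hat y=C\hat x$, $\hat q=C_q\hat x$; controller update times $t_0^u=0<t_1^u<\cdots$ with $\hat x_s(t)=\hat x(t_k^u)$ for $t\in[t_k^u,t_{k+1}^u)$, $t_{k+1}^u=\inf\{t\mid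 t\ge t_k^u+\tau_u,\ \|\hat x_s(t)-\hat x(t)\|>\sigma_u\|\hat x(t)\|+\epsilon_u\}$, and input $u(t)=K_1\hat x_s(t)+K_2p(C_q\hat x_s(t))$. Then positive numbers $\tau_y,\sigma_y,\epsilon_y,\tau_u,\sigma_u,\epsilon_u$ can be chosen such that this event-triggered closed-loop system is input-to-state practically stable with respect to $w$.
   Context: Plant: $x\in\mathbb{R}^{n_x}$ state, $u\in\mathbb{R}^{n_u}$ input, $y\in\mathbb{R}^{n_y}$ output, $w\in\mathbb{R}^{n_w}$ unknown measurable disturbance; $A,B,C,C_q,E,E_w$ constant real matrices of compatible sizes; $p:\mathbb{R}^{n_q}\to\mathbb{R}^{n_p}$ known with $p(0)=0$. The closed loop is input-to-state practically stable (ISpS) w.r.t. $w$ if there exist $\beta_1\in\mathcal{KL}$, $\beta_2\in\mathcal K$ and a constant $d\ge0$ such that for every initial condition $(x(0),\hat x(0))$ and every admissible disturbance $w$, $\|z(t)\|\le\beta_1(\|z(0)\|,t)+\beta_2(\|w\|_\infty)+d$ for all $t\ge0$, where $z=(x^\top,(x-\hat x)^\top)^\top$ and $\|w\|_\infty=\sup_{t\ge0}\|w(t)\|$. *)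

(* Defs.v *)
From HB Require Import structures.
From mathcomp Require Import all_boot all_order all_algebra.
From mathcomp Require Import all_classical all_reals all_analysis.
Set Implicit Arguments. Unset Strict Implicit. Unset Printing Implicit Defensive.
Import Order.TTheory GRing.Theory Num.Theory.
Import numFieldNormedType.Exports.
Local Open Scope classical_set_scope.
Local Open Scope ring_scope.

Section Defs.
Variable R : realType.

Definition enorm (n : nat) (v : 'cV[R]_n) : R :=
  Num.sqrt (\sum_(i < n) v i 0 ^+ 2).

Definition qform (n : nat) (P : 'M[R]_n) (z : 'cV[R]_n) : R := (z^T *m P *m z) 0 0.

Definition posdef (n : nat) (P : 'M[R]_n) : Prop :=
  P^T = P /\ forall z : 'cV[R]_n, z != 0 -> 0 < qform P z.

Definition glob_lipschitz (m n : nat) (f : 'cV[R]_m -> 'cV[R]_n) : Prop :=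
  exists Lf : R, forall a b, enorm (f a - f b) <= Lf * enorm (a - b).

Definition classK (b : R -> R) : Prop :=
  [/\ b 0 = 0, {within `[0, +oo[, continuous b} &
      forall r s, 0 <= r -> r < s -> b r < b s].

Definition classKL (b : R -> R -> R) : Prop :=
  (forall t, 0 <= t -> classK (fun r => b r t)) /\
  (forall r, 0 <= r ->
     (forall t s, 0 <= t -> t <= s -> b r s <= b r t) /\
     (b r t @[t --> +oo] --> 0)).

Definition zvec (nx : nat) (x xh : 'cV[R]_nx) : 'cV[R]_(nx + nx) := col_mx x (x - xh).

Definition sup_norm (nw : nat) (w : R -> 'cV[R]_nw) : R :=
  sup [set enorm (w t) | t in `[0, +oo[].

(* Nominal (continuous-time) hypothesis: along the closed loop with w = 0,
   Vdot(z) = zdot^T P z + z^T P zdot <= - alpha0 V(z), at every state. *)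
Definition nominal_decrease (nx nu ny nq np : nat)
  (A : 'M[R]_nx) (B : 'M[R]_(nx, nu)) (C : 'M[R]_(ny, nx)) (Cq : 'M[R]_(nq, nx))
  (E : 'M[R]_(nx, np)) (p : 'cV[R]_nq -> 'cV[R]_np)
  (K1 : 'M[R]_(nu, nx)) (K2 : 'M[R]_(nu, np)) (L1 : 'M[R]_(nq, ny)) (L2 : 'M[R]_(nx, ny))
  (P : 'M[R]_(nx + nx)) (alpha0 : R) : Prop :=
  forall x xh : 'cV[R]_nx,
    let u := K1 *m xh + K2 *m p (Cq *m xh) in
    let fx := A *m x + B *m u + E *m p (Cq *m x) in
    let fxh := A *m xh + B *m u + E *m p (Cq *m xh + L1 *m (C *m xh - C *m x))
               + L2 *m (C *m xh - C *m x) in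
    let z := zvec x xh in
    let dz := col_mx fx (fx - fxh) in
    (dz^T *m P *m z) 0 0 + (z^T *m P *m dz) 0 0 <= - alpha0 * qform P z.

(* trigger time after a sample taken at time tk (finite):
   inf { t | t >= tk + tau, ||s - v(t)|| > sig ||v(t)|| + eps }, inf of empty set = +oo *)
Definition next_trigger (n : nat) (v : R -> 'cV[R]_n) (tk tau sig eps : R) : \bar R :=
  ereal_inf [set t%:E | t in [set t | tk + tau <= t /\
                      sig * enorm (v t) + eps < enorm (v tk - v t)]].

(* A sample-and-hold signal with event-triggered sampling times ts : nat -> \bar R
   (value +oo means: no further sampling) *)
Definition etm_sampling (n : nat) (v : R -> 'cV[R]_n) (tau sig eps : R)
  (ts : nat -> \bar R) (vs : R -> 'cV[R]_n) : Prop :=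
  [/\ ts 0%N = 0%:E,
      (forall k, ts k = +oo%E -> ts k.+1 = +oo%E),
      (forall k, ts k != +oo%E -> ts k.+1 = next_trigger v (fine (ts k)) tau sig eps) &
      (forall k (t : R), (ts k <= t%:E)%E -> (t%:E < ts k.+1)%E -> vs t = v (fine (ts k)))].

Definition carath_sol (n : nat) (x f : R -> 'cV[R]_n) : Prop :=
  forall t : R, 0 <= t -> forall i : 'I_n,
    (@lebesgue_measure R).-integrable `[0, t] (fun s => (f s i 0)%:E) /\
    x t i 0 = x 0 i 0 + Rintegral (@lebesgue_measure R) `[0, t] (fun s => f s i 0).

Definition etc_solution (nx nu ny nq np nw : nat)
  (A : 'M[R]_nx) (B : 'M[R]_(nx, nu)) (C : 'M[R]_(ny, nx)) (Cq : 'M[R]_(nq, nx))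
  (E : 'M[R]_(nx, np)) (Ew : 'M[R]_(nx, nw)) (p : 'cV[R]_nq -> 'cV[R]_np)
  (K1 : 'M[R]_(nu, nx)) (K2 : 'M[R]_(nu, np)) (L1 : 'M[R]_(nq, ny)) (L2 : 'M[R]_(nx, ny))
  (tauy sigy epsy tauu sigu epsu : R)
  (w : R -> 'cV[R]_nw) (x xh : R -> 'cV[R]_nx)
  (ty tu : nat -> \bar R) (ys : R -> 'cV[R]_ny) (xhs : R -> 'cV[R]_nx) : Prop :=
  let u := fun s => K1 *m xhs s + K2 *m p (Cq *m xhs s) in
  [/\ etm_sampling (fun s => C *m x s) tauy sigy epsy ty ys,
      etm_sampling xh tauu sigu epsu tu xhs,
      carath_sol x (fun s => A *m x s + B *m u s + E *m p (Cq *m x s) + Ew *m w s) &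
      carath_sol xh (fun s => A *m xh s + B *m u s
                        + E *m p (Cq *m xh s + L1 *m (C *m xh s - ys s))
                        + L2 *m (C *m xh s - ys s))].

Definition etc_ISpS (nx nu ny nq np nw : nat)
  (A : 'M[R]_nx) (B : 'M[R]_(nx, nu)) (C : 'M[R]_(ny, nx)) (Cq : 'M[R]_(nq, nx))
  (E : 'M[R]_(nx, np)) (Ew : 'M[R]_(nx, nw)) (p : 'cV[R]_nq -> 'cV[R]_np)
  (K1 : 'M[R]_(nu, nx)) (K2 : 'M[R]_(nu, np)) (L1 : 'M[R]_(nq, ny)) (L2 : 'M[R]_(nx, ny))
  (tauy sigy epsy tauu sigu epsu omega0 : R) : Prop :=
  exists (b1 : R -> R -> R) (b2 : R -> R) (d : R),
    [/\ classKL b1, classK b2, 0 <= d &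
     forall (w : R -> 'cV[R]_nw) (x xh : R -> 'cV[R]_nx)
            (ty tu : nat -> \bar R) (ys : R -> 'cV[R]_ny) (xhs : R -> 'cV[R]_nx),
       (forall i : 'I_nw, measurable_fun (`[0, +oo[ : set R) (fun t : R => w t i 0)) ->
       (forall t, 0 <= t -> enorm (w t) <= omega0) ->
       etc_solution A B C Cq E Ew p K1 K2 L1 L2 tauy sigy epsy tauu sigu epsu
                    w x xh ty tu ys xhs ->
       forall t, 0 <= t ->
         enorm (zvec (x t) (xh t))
           <= b1 (enorm (zvec (x 0) (xh 0))) t + b2 (sup_norm w) + d].

End Defs.

(* Main.v *)
(**
The extended state z = (x, x - xh) obeys z' = F z + r, where F is the nominal
closed loop and, everything being Lipschitz, |r| <= c (|e_y| + |e_u| + |w|) with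
e_y, e_u the two sampling errors.  Fix T and weight all signals by exp (lam t),
lam = alpha0 / 4.  The Lyapunov function bounds the weighted supremum over
[0, T] of |z| by that of |r|.  Conversely each sampling error is controlled
either by the growth of z over a dwell time of length tau, or by the triggering
threshold sig |y| + 1, so its weighted supremum is a small multiple of the
others up to a constant.  Closing the loop for small tau and sig, the weighted
supremum is bounded by C |z 0| + C exp (lam T) (|w| + 1); dividing by
exp (lam T) gives the estimate at time T.

Solutions are only absolutely continuous, but r is bounded on [0, T], so z and
V (z t) are Lipschitz there and the Lyapunov estimate needs only one-sided
difference quotients of V along z, no almost-everywhere derivative.
*)

Require Import Defs.
From HB Require Import structures.
From mathcomp Require Import all_boot all_order all_algebra.
From mathcomp Require Import all_classical all_reals all_analysis.
From mathcomp Require Import ring lra.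
Set Implicit Arguments. Unset Strict Implicit. Unset Printing Implicit Defensive.
Import Order.TTheory GRing.Theory Num.Theory.
Import numFieldNormedType.Exports.
Local Open Scope classical_set_scope.
Local Open Scope ring_scope.

(** * Euclidean norm, quadratic forms and globally Lipschitz maps *)

Section EuclideanNorm.
Context {R : realType}.
Implicit Types n : nat.

(** The polar form of [qform]: [qform P z] unfolds to [bform P z z], so the Lyapunov function can be
    expanded by bilinearity. *)
Definition bform n (P : 'M[R]_n) (a b : 'cV[R]_n) : R := (a^T *m P *m b) 0 0.

Lemma bformDl n (P : 'M[R]_n) a b c :
  bform P (a + b) c = bform P a c + bform P b c.
Proof. by rewrite /bform linearD /= !mulmxDl mxE. Qed.

Lemma bformDr n (P : 'M[R]_n) a b c :
  bform P a (b + c) = bform P a b + bform P a c.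
Proof. by rewrite /bform mulmxDr mxE. Qed.

Lemma bformZl n (P : 'M[R]_n) k a b : bform P (k *: a) b = k * bform P a b.
Proof. by rewrite /bform linearZ /= -!scalemxAl mxE. Qed.

Lemma bformZr n (P : 'M[R]_n) k a b : bform P a (k *: b) = k * bform P a b.
Proof. by rewrite /bform -scalemxAr mxE. Qed.

Lemma bformC n (P : 'M[R]_n) a b : P^T = P -> bform P a b = bform P b a.
Proof.
move=> sP; have -> : bform P a b = ((a^T *m P *m b)^T) 0 0 by rewrite [RHS]mxE.
by rewrite !trmx_mul trmxK sP mulmxA.
Qed.

(** Nonnegativity of [qform P] at [a - t b], for the minimising [t], multiplied by [qform P b]. *)
Lemma bform_CauchySchwarz n (P : 'M[R]_n) a b : posdef P ->
  bform P a b ^+ 2 <= qform P a * qform P b.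
Proof.
move=> [sP pP]; have [->|b0] := eqVneq b 0.
  by rewrite /bform /qform !mulmx0 !mxE expr0n mulr0.
have qb := pP b b0; set t := bform P a b / qform P b.
have q0 : 0 <= qform P (a + (- t) *: b).
  have [->|] := eqVneq (a + (- t) *: b) 0; last by move/pP/ltW.
  by rewrite /qform mulmx0 mxE.
move: q0; rewrite /qform -!/(bform _ _ _) !bformDl !bformDr !bformZl !bformZr.
rewrite (bformC b a sP).
have tE : t * bform P b b = bform P a b by rewrite /t divfK// gt_eqF.
have -> : bform P a a + - t * bform P a b
          + (- t * bform P a b + - t * (- t * bform P b b))
        = bform P a a - t * bform P a b.
  by rewrite -[in RHS]tE -[in LHS]tE; ring.
move=> q0; have : 0 <= (bform P a a - t * bform P a b) * bform P b b.
  by rewrite mulr_ge0// ltW.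
by rewrite mulrBl mulrAC tE -expr2 subr_ge0.
Qed.

Lemma enorm_ge0 n (v : 'cV[R]_n) : 0 <= enorm v.
Proof. exact: sqrtr_ge0. Qed.

Lemma sqr_enorm n (v : 'cV[R]_n) : enorm v ^+ 2 = \sum_i v i 0 ^+ 2.
Proof. by rewrite sqr_sqrtr// sumr_ge0// => i _; exact: sqr_ge0. Qed.

Lemma bform1 n (a b : 'cV[R]_n) : bform 1%:M a b = \sum_i a i 0 * b i 0.
Proof. by rewrite /bform mulmx1 mxE; apply: eq_bigr => i _; rewrite mxE. Qed.

Lemma qform1 n (v : 'cV[R]_n) : qform 1%:M v = enorm v ^+ 2.
Proof.
rewrite sqr_enorm -[LHS]/(bform _ _ _) bform1.
by apply: eq_bigr => i _; rewrite expr2.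
Qed.

Lemma enorm0 n : enorm (0 : 'cV[R]_n) = 0.
Proof. by rewrite /enorm big1 ?sqrtr0// => i _; rewrite mxE expr0n. Qed.

Lemma ler_coord_enorm n (v : 'cV[R]_n) i : `|v i 0| <= enorm v.
Proof.
rewrite -(@ler_pXn2r _ 2)// ?nnegrE ?enorm_ge0// sqr_enorm real_normK ?num_real//.
by rewrite (bigD1 i)//= lerDl sumr_ge0// => j _; exact: sqr_ge0.
Qed.

Lemma enorm_eq0 n (v : 'cV[R]_n) : enorm v = 0 -> v = 0.
Proof.
move=> v0; apply/colP => i; rewrite mxE; apply/eqP.
by rewrite -normr_le0 -v0 ler_coord_enorm.
Qed.

Lemma posdef1 n : posdef (1%:M : 'M[R]_n).
Proof.
split=> [|z z0]; first exact: trmx1.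
rewrite qform1 exprn_gt0// lt_def enorm_ge0 andbT.
by apply: contra z0 => /eqP/enorm_eq0/eqP.
Qed.

Lemma ler_bform1 n (a b : 'cV[R]_n) : `|bform 1%:M a b| <= enorm a * enorm b.
Proof.
rewrite -(@ler_pXn2r _ 2)// ?nnegrE ?mulr_ge0 ?enorm_ge0//.
rewrite real_normK ?num_real// exprMn -!qform1.
exact/bform_CauchySchwarz/posdef1.
Qed.

Lemma ler_enormD n (a b : 'cV[R]_n) : enorm (a + b) <= enorm a + enorm b.
Proof.
rewrite -(@ler_pXn2r _ 2)// ?nnegrE ?addr_ge0 ?enorm_ge0//.
rewrite -qform1 /qform -/(bform _ _ _) !bformDl !bformDr.
have := ler_bform1 a b; have := ler_bform1 b a.
have qE v : bform 1%:M v v = enorm v ^+ 2 := qform1 v.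
rewrite !qE => /(le_trans (ler_norm _)) h1 /(le_trans (ler_norm _)) h2; rewrite sqrrD; lra.
Qed.

Lemma enormZ n k (v : 'cV[R]_n) : enorm (k *: v) = `|k| * enorm v.
Proof.
rewrite /enorm -sqrtr_sqr -sqrtrM ?sqr_ge0//; congr Num.sqrt.
by rewrite mulr_sumr; apply: eq_bigr => i _; rewrite mxE exprMn.
Qed.

Lemma enormN n (v : 'cV[R]_n) : enorm (- v) = enorm v.
Proof. by rewrite -scaleN1r enormZ normrN1 mul1r. Qed.

Lemma enorm_distC n (a b : 'cV[R]_n) : enorm (a - b) = enorm (b - a).
Proof. by rewrite -enormN opprB. Qed.

Lemma ler_enormB n (a b : 'cV[R]_n) : enorm (a - b) <= enorm a + enorm b.
Proof. by rewrite -(enormN b) ler_enormD. Qed.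

(** The factor [n] is cruder than its square root but avoids roots; only the existence of constants
    matters later. *)
Lemma enorm_le_coord n (v : 'cV[R]_n) c :
  (forall i, `|v i 0| <= c) -> 0 <= c -> enorm v <= n%:R * c.
Proof.
move=> vc c0; rewrite -(@ler_pXn2r _ 2)// ?nnegrE ?mulr_ge0 ?enorm_ge0//.
rewrite sqr_enorm; apply: (@le_trans _ _ (\sum_(i < n) c ^+ 2)).
  apply: ler_sum => i _; rewrite -real_normK ?num_real// ler_pXn2r// nnegrE//.
rewrite sumr_const card_ord -(mulr_natl (c ^+ 2)) exprMn ler_wpM2r ?sqr_ge0//.
by rewrite -natrX ler_nat; case: (n) => // m; rewrite expnS expn1 leq_pmull.
Qed.

Lemma mulmx_enorm_bound m n (M : 'M[R]_(m, n)) :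
  exists2 c, 0 <= c & forall v, enorm (M *m v) <= c * enorm v.
Proof.
pose s := \sum_i \sum_j `|M i j|.
have s0 : 0 <= s by apply: sumr_ge0 => i _; apply: sumr_ge0.
exists (m%:R * s) => [|v]; first by rewrite mulr_ge0.
rewrite -mulrA; apply: enorm_le_coord => [i|]; last by rewrite mulr_ge0 ?enorm_ge0.
rewrite mxE; apply: le_trans (ler_norm_sum _ _ _) _.
apply: (@le_trans _ _ (\sum_j `|M i j| * enorm v)).
  by apply: ler_sum => j _; rewrite normrM ler_wpM2l// ler_coord_enorm.
rewrite -mulr_suml ler_wpM2r ?enorm_ge0// /s (bigD1 i)//= lerDl.
by apply: sumr_ge0 => k _; apply: sumr_ge0.
Qed.

Lemma sqr_enorm_col m n (a : 'cV[R]_m) (b : 'cV[R]_n) :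
  enorm (col_mx a b) ^+ 2 = enorm a ^+ 2 + enorm b ^+ 2.
Proof.
rewrite !sqr_enorm big_split_ord /=; congr (_ + _).
  by apply: eq_bigr => i _; rewrite col_mxEu.
by apply: eq_bigr => i _; rewrite col_mxEd.
Qed.

Lemma ler_enorm_col m n (a : 'cV[R]_m) (b : 'cV[R]_n) :
  enorm (col_mx a b) <= enorm a + enorm b.
Proof.
rewrite -(@ler_pXn2r _ 2)// ?nnegrE ?addr_ge0 ?enorm_ge0//.
rewrite sqr_enorm_col sqrrD; have := mulr_ge0 (enorm_ge0 a) (enorm_ge0 b); lra.
Qed.

(** The lower bound on [qform P] needs neither eigenvalues nor compactness. [P] is invertible
    because [qform P] vanishes on its kernel, and Cauchy-Schwarz for [a] and [invmx P *m a] bounds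
    the fourth power of [enorm a] by [qform P a] times the Euclidean product of [invmx P *m a] and
    [a]. *)
Lemma posdef_bounds n (P : 'M[R]_n) : posdef P ->
  exists p q, [/\ 0 <= p, 0 <= q,
    forall a b, `|bform P a b| <= p * enorm a * enorm b &
    forall a, enorm a ^+ 2 <= q ^+ 2 * qform P a].
Proof.
move=> pdP; have [sP pP] := pdP.
have [p p0 Pp] := mulmx_enorm_bound P.
have Pb a b : `|bform P a b| <= p * enorm a * enorm b.
  have -> : bform P a b = bform 1%:M (P *m a) b.
    by rewrite /bform trmx_mul sP mulmx1.
  apply: le_trans (ler_bform1 _ _) _; rewrite ler_wpM2r ?enorm_ge0//.
have uP : P \in unitmx.
  rewrite -row_free_unit -kermx_eq0; apply/eqP/row_matrixP => i.
  rewrite row0; apply/eqP/negPn/negP => ki0.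
  have /pP : (row i (kermx P))^T != 0.
    by apply: contra ki0 => /eqP k0; rewrite -[row _ _]trmxK k0 trmx0.
  by rewrite /qform trmxK -row_mul mulmx_ker row0 mul0mx mxE ltxx.
have [r r0 Pr] := mulmx_enorm_bound (invmx P).
(* With the square root of the bound [r] on [invmx P], the norm is at most [q] times the square root
   of [qform P]. *)
exists p, (Num.sqrt r); split; rewrite ?sqrtr_ge0// => a; rewrite (sqr_sqrtr r0).
have [a0|a0] := eqVneq (enorm a) 0.
  rewrite a0 expr0n mulr_ge0//; have [->|/pP/ltW//] := eqVneq a 0.
  by rewrite /qform mulmx0 mxE.
have ap : 0 < enorm a ^+ 2 by rewrite exprn_gt0// lt_def a0 enorm_ge0.
have qE : qform P (invmx P *m a) = bform 1%:M (invmx P *m a) a.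
  by rewrite /qform /bform mulmx1 -mulmxA mulKVmx.
have bE : bform P a (invmx P *m a) = enorm a ^+ 2.
  by rewrite -qform1 /qform /bform mulmx1 -mulmxA mulKVmx.
have := bform_CauchySchwarz a (invmx P *m a) pdP.
rewrite bE expr2 qE => h; rewrite -(@ler_pM2r _ (enorm a ^+ 2))//.
apply: le_trans h _.
have qa : 0 <= qform P a.
  by have [->|/pP/ltW//] := eqVneq a 0; rewrite /qform mulmx0 mxE.
rewrite [r * _]mulrC -mulrA ler_wpM2l// (le_trans (ler_norm _))//.
by rewrite (le_trans (ler_bform1 _ _))// expr2 mulrA ler_wpM2r ?enorm_ge0.
Qed.

Lemma glob_lipschitz_ge0 m n (f : 'cV[R]_m -> 'cV[R]_n) : glob_lipschitz f ->
  exists2 L, 0 <= L & forall a b, enorm (f a - f b) <= L * enorm (a - b).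
Proof.
move=> [L fL]; exists `|L| => // a b; apply: le_trans (fL a b) _.
by rewrite ler_wpM2r ?enorm_ge0// ler_norm.
Qed.

(** This and the next closure rules let the Lipschitz property of the closed-loop field be assembled
    term by term. *)
Lemma glob_lipschitz_add m n (f g : 'cV[R]_m -> 'cV[R]_n) :
  glob_lipschitz f -> glob_lipschitz g -> glob_lipschitz (fun v => f v + g v).
Proof.
move=> [Lf fL] [Lg gL]; exists (Lf + Lg) => a b.
by rewrite opprD addrACA mulrDl (le_trans (ler_enormD _ _))// lerD.
Qed.

Lemma glob_lipschitz_opp m n (f : 'cV[R]_m -> 'cV[R]_n) :
  glob_lipschitz f -> glob_lipschitz (fun v => - f v).
Proof. by move=> [L fL]; exists L => a b; rewrite -opprD enormN. Qed.

Lemma glob_lipschitz_comp m n k (f : 'cV[R]_m -> 'cV[R]_n) (g : 'cV[R]_k -> 'cV[R]_m) :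
  glob_lipschitz f -> glob_lipschitz g -> glob_lipschitz (fun v => f (g v)).
Proof.
move=> /glob_lipschitz_ge0[Lf Lf0 fL] [Lg gL]; exists (Lf * Lg) => a b.
by rewrite (le_trans (fL _ _))// -mulrA ler_wpM2l.
Qed.

Lemma glob_lipschitz_mulmx m n k (M : 'M[R]_(n, m)) (g : 'cV[R]_k -> 'cV[R]_m) :
  glob_lipschitz g -> glob_lipschitz (fun v => M *m g v).
Proof.
apply: (@glob_lipschitz_comp _ _ _ (mulmx M)); have [c _ Mc] := mulmx_enorm_bound M.
by exists c => a b; rewrite -mulmxBr.
Qed.

Lemma glob_lipschitz_col m n k (f : 'cV[R]_k -> 'cV[R]_m) (g : 'cV[R]_k -> 'cV[R]_n) :
  glob_lipschitz f -> glob_lipschitz g -> glob_lipschitz (fun v => col_mx (f v) (g v)).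
Proof.
move=> [Lf fL] [Lg gL]; exists (Lf + Lg) => a b.
by rewrite opp_col_mx add_col_mx mulrDl (le_trans (ler_enorm_col _ _))// lerD.
Qed.

Lemma glob_lipschitz_usub m n k (f : 'cV[R]_k -> 'cV[R]_(m + n)) :
  glob_lipschitz f -> glob_lipschitz (fun v => usubmx (f v)).
Proof.
move=> [L fL]; exists L => a b; apply: le_trans (fL a b); rewrite -linearB /=.
rewrite -(@ler_pXn2r _ 2)// ?nnegrE ?enorm_ge0//.
by rewrite -[X in _ <= enorm X ^+ 2]vsubmxK sqr_enorm_col lerDl sqr_ge0.
Qed.

Lemma glob_lipschitz_dsub m n k (f : 'cV[R]_k -> 'cV[R]_(m + n)) :
  glob_lipschitz f -> glob_lipschitz (fun v => dsubmx (f v)).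
Proof.
move=> [L fL]; exists L => a b; apply: le_trans (fL a b); rewrite -linearB /=.
rewrite -(@ler_pXn2r _ 2)// ?nnegrE ?enorm_ge0//.
by rewrite -[X in _ <= enorm X ^+ 2]vsubmxK sqr_enorm_col lerDr sqr_ge0.
Qed.

Lemma glob_lipschitz_id n : glob_lipschitz (fun v : 'cV[R]_n => v).
Proof. by exists 1 => a b; rewrite mul1r. Qed.

End EuclideanNorm.

(** * Carathéodory solutions, event-triggered sampling and a barrier principle *)

Section Trajectories.
Context {R : realType}.
Notation mu := (@lebesgue_measure R).

(** Each coordinate of [f] stays within [k] of that of [c], hence so does its mean over the
    interval. Taking for [c] the nominal field at [z a] gives a first-order expansion without
    differentiating [z]. *)
Lemma carath_increment n (z f : R -> 'cV[R]_n) (a b k : R) (c : 'cV[R]_n) :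
  carath_sol z f -> 0 <= a -> a <= b -> 0 <= k ->
  (forall s, a <= s -> s <= b -> enorm (f s - c) <= k) ->
  enorm (z b - z a - (b - a) *: c) <= n%:R * ((b - a) * k).
Proof.
move=> zf a0 ab k0 fk; have b0 : 0 <= b := le_trans a0 ab.
have ba0 : 0 <= b - a by rewrite subr_ge0.
apply: enorm_le_coord => [i|]; last by rewrite mulr_ge0.
have [_ za] := zf a a0 i; have [fb zb] := zf b b0 i.
(* The interval is half-open because it is the difference of the closed intervals from 0 to [b] and
   from 0 to [a]. *)
have fab : mu.-integrable `]a, b] (EFin \o (fun s => f s i 0)).
  apply: integrableS fb => //; apply: subset_itv; rewrite ?bnd_simp//.
have -> : (z b - z a - (b - a) *: c) i 0 =
    Rintegral mu `]a, b] (fun s => f s i 0) - (b - a) * c i 0.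
  by rewrite -(Rintegral_itvB fb) ?bnd_simp// !mxE zb za; ring.
have mab : (mu `]a, b]) = (b - a)%:E.
  rewrite lebesgue_measure_itv /= lte_fin; case: ltP => // ba.
  have -> : b = a by apply: le_anti; rewrite ba ab.
  by rewrite subrr.
have icst (e : R) : mu.-integrable `]a, b] (EFin \o (fun=> e)).
  apply: measurable_bounded_integrable => //.
  - by apply: (@le_lt_trans _ _ (b - a)%:E); rewrite ?ltry// -mab.
  - by exists `|e|; split; rewrite ?num_real// => x xe y _ /=; exact: ltW.
have cst (e : R) : Rintegral mu `]a, b] (fun=> e) = e * (b - a).
  by rewrite Rintegral_cst//; congr (_ * _); exact: (congr1 fine mab).
have bd s : [set` `]a, b]] s -> `|f s i 0 - c i 0| <= k.
  rewrite /= in_itv /= => /andP[as_ sb]; have := fk s (ltW as_) sb.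
  by apply: le_trans; have := ler_coord_enorm (f s - c) i; rewrite !mxE.
have lo : (c i 0 - k) * (b - a) <= Rintegral mu `]a, b] (fun s => f s i 0).
  rewrite -cst; apply: le_Rintegral => // s /bd; rewrite ler_norml => /andP[]; lra.
have hi : Rintegral mu `]a, b] (fun s => f s i 0) <= (c i 0 + k) * (b - a).
  rewrite -cst; apply: le_Rintegral => // s /bd; rewrite ler_norml => /andP[]; lra.
move: lo hi; move: (Rintegral _ _ _) => I lo hi; clear -lo hi.
rewrite ler_norml; apply/andP; split; lra.
Qed.

Lemma carath_lipschitz n (z f : R -> 'cV[R]_n) (a b k : R) :
  carath_sol z f -> 0 <= a -> a <= b -> 0 <= k ->
  (forall s, a <= s -> s <= b -> enorm (f s) <= k) ->
  enorm (z b - z a) <= n%:R * ((b - a) * k).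
Proof.
move=> zf a0 ab k0 fk; have := @carath_increment _ _ _ a b k 0 zf a0 ab k0.
by rewrite scaler0 subr0; apply => s sa sb; rewrite subr0 fk.
Qed.

(** A qualitative bound: its size never enters the final constants, it only makes suprema finite and
    [V] Lipschitz along [z]. *)
Lemma carath_bounded n (z f : R -> 'cV[R]_n) (T : R) : carath_sol z f -> 0 <= T ->
  exists2 M, 0 <= M & forall t, 0 <= t -> t <= T -> enorm (z t) <= M.
Proof.
move=> zf T0.
pose S i := `|z 0 i 0| + Rintegral mu `[0, T] (fun s => `|f s i 0|).
have S0 i : 0 <= S i by rewrite addr_ge0// Rintegral_ge0.
have sS0 : 0 <= \sum_i S i by apply: sumr_ge0.
exists (n%:R * \sum_i S i) => [|t t0 tT]; first by rewrite mulr_ge0.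
apply: enorm_le_coord => // i.
apply: (@le_trans _ _ (S i)); last by rewrite (bigD1 i)//= lerDl sumr_ge0.
have [ft ->] := zf t t0 i; have [fT _] := zf T T0 i.
apply: le_trans (ler_normD _ _) _; rewrite lerD2l.
apply: le_trans (le_normr_Rintegral _ ft) _ => //.
have fTn : mu.-integrable `[0, T] (EFin \o (fun s => `|f s i 0|)).
  exact: integrable_norm fT.
by rewrite -subr_ge0 (Rintegral_itvB fTn) ?bnd_simp// Rintegral_ge0.
Qed.

Lemma carath_col m n (x f : R -> 'cV[R]_m) (y g : R -> 'cV[R]_n) :
  carath_sol x f -> carath_sol y g ->
  carath_sol (fun s => col_mx (x s) (y s)) (fun s => col_mx (f s) (g s)).
Proof.
move=> xf yg t t0 i; case: (split_ordP i) => j ->.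
  have [fi xE] := xf t t0 j; split.
    by apply: eq_integrable fi => // s _; rewrite col_mxEu.
  by rewrite !col_mxEu xE; congr (_ + _); apply: eq_Rintegral => s _; rewrite col_mxEu.
have [gi yE] := yg t t0 j; split.
  by apply: eq_integrable gi => // s _; rewrite col_mxEd.
by rewrite !col_mxEd yE; congr (_ + _); apply: eq_Rintegral => s _; rewrite col_mxEd.
Qed.

Lemma carath_sub n (x f y g : R -> 'cV[R]_n) :
  carath_sol x f -> carath_sol y g ->
  carath_sol (fun s => x s - y s) (fun s => f s - g s).
Proof.
move=> xf yg t t0 i; have [fi xE] := xf t t0 i; have [gi yE] := yg t t0 i; split.
  by apply: eq_integrable (integrableB _ fi gi) => // s _; rewrite !mxE EFinB.
rewrite !mxE xE yE opprD addrACA -RintegralB//; congr (_ + _).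
by apply: eq_Rintegral => s _; rewrite !mxE.
Qed.

(** The dwell time [tau] excludes Zeno behaviour, so [t] lies between two consecutive sampling
    times; past the dwell time, a violated threshold at [t] would have triggered by then. *)
Lemma etm_hold n (v : R -> 'cV[R]_n) tau sig eps ts vs t :
  0 < tau -> etm_sampling v tau sig eps ts vs -> 0 <= t ->
  exists tk, [/\ 0 <= tk, tk <= t, vs t = v tk &
    t < tk + tau \/ enorm (v tk - v t) <= sig * enorm (v t) + eps].
Proof.
move=> tau0 [ts0 tsoo tsS vsE] t0.
have ts_ge k : ((k%:R * tau)%:E <= ts k)%E.
  elim: k => [|k IH]; first by rewrite mul0r ts0.
  have [tk|tk] := eqVneq (ts k) +oo%E; first by rewrite tsoo// leey.
  rewrite tsS//; apply: le_ereal_inf_tmp => _ [s [ks _] <-].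
  rewrite lee_fin; apply: le_trans ks; rewrite -natr1 mulrDl mul1r lerD2r.
  by move: IH tk; case: (ts k).
have extm : exists m, (t%:E < ts m)%E.
  exists (Num.truncn (t / tau)).+1; apply: lt_le_trans (ts_ge _).
  by rewrite lte_fin -ltr_pdivrMr// truncnS_gt.
(* The least index whose sampling time exceeds [t] is a successor, since sampling starts at time 0;
   its predecessor is the active sample. *)
case: (ex_minnP extm) => -[|k] tk kmin.
  by move: tk; rewrite ts0 lte_fin ltNge t0.
have kt : (ts k <= t%:E)%E by rewrite leNgt; apply/negP => /kmin; rewrite ltnn.
have tkoo : ts k != +oo%E by apply: contraTneq kt => ->; rewrite -ltNge ltry.
have tkE : ts k = (fine (ts k))%:E.
  by move: (ts_ge k) tkoo; case: (ts k).
exists (fine (ts k)); split.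
- by rewrite -lee_fin -tkE (le_trans _ (ts_ge k))// lee_fin mulr_ge0// ltW.
- by rewrite -lee_fin -tkE.
- exact: vsE.
have [|ht] := ltP t (fine (ts k) + tau); first by left.
right; rewrite leNgt; apply/negP => trig.
move: tk; rewrite tsS// ltNge => /negP; apply; apply: ereal_inf_lbound.
by exists t.
Qed.

(** If [g t] were positive, the last earlier time with [g] nonpositive could be moved forward: by
    continuity if [g] is negative there, by the hypothesis on zeros otherwise. That hypothesis
    replaces a sign condition on the derivative. *)
Lemma lipschitz_barrier (g : R -> R) (T K : R) :
  (forall s t, 0 <= s -> s <= t -> t <= T -> `|g t - g s| <= K * (t - s)) ->
  g 0 <= 0 ->
  (forall s, 0 <= s -> s < T -> g s = 0 -> exists2 h0, 0 < h0 &
     forall h, 0 < h -> h <= h0 -> s + h <= T -> g (s + h) <= 0) ->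
  forall t, 0 <= t -> t <= T -> g t <= 0.
Proof.
move=> gK g0 gz t t0 tT; rewrite leNgt; apply/negP => gt.
have K0 : 0 <= K.
  rewrite leNgt; apply/negP => K0; have := gK 0 t (lexx _) t0 tT.
  rewrite subr0 => /(le_trans (normr_ge0 _)).
  rewrite nmulr_rge0// => t0'; move: gt g0; rewrite (_ : t = 0); first lra.
  by apply: le_anti; rewrite t0 t0'.
pose S := [set s | [/\ 0 <= s, s <= t & g s <= 0]].
have S0 : S 0 by split.
have Sub : ubound S t by move=> s [].
have hS : has_sup S by split; [exists 0|exists t].
set s0 := sup S.
have s00 : 0 <= s0 by exact: sup_upper_bound.
have s0t : s0 <= t by apply: ge_sup => //; exists 0.
have gs0 : g s0 <= 0.
  rewrite leNgt; apply/negP => gs0.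
  (* Dividing by [K + 1] covers the case where [K] is zero; points this close to [s0] still have [g]
     positive. *)
  have d0 : 0 < g s0 / (K + 1) by rewrite divr_gt0// ltr_wpDl.
  have [s [sp st gs] ds] := sup_adherent d0 hS.
  have ss0 : s <= s0 by apply: sup_upper_bound.
  have := gK s s0 sp ss0 (le_trans s0t tT).
  move=> /(le_trans (ler_norm _)); have : (K + 1) * (s0 - s) < g s0.
    by rewrite mulrC -ltr_pdivlMr ?ltr_wpDl// ltrBlDl -ltrBlDr.
  by move=> h1 h2; nra.
have {}s0t : s0 < t.
  by rewrite lt_neqAle s0t andbT; apply: contraTneq gt => <-; rewrite -leNgt.
have [h0 h0p hg] : exists2 h0, 0 < h0 &
    forall h, 0 < h -> h <= h0 -> s0 + h <= T -> g (s0 + h) <= 0.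
  have [gE|gN] := eqVneq (g s0) 0; first by apply: gz => //; exact: lt_le_trans tT.
  have gs0' : 0 < - g s0 by rewrite oppr_gt0 lt_neqAle gN.
  have K1 : 0 < K + 1 by rewrite ltr_wpDl.
  exists (- g s0 / (K + 1)) => [|h h0 hh hT]; first by rewrite divr_gt0.
  have s0h : s0 <= s0 + h by rewrite lerDl ltW.
  move: hh; rewrite ler_pdivlMr// => hh.
  have := gK s0 (s0 + h) s00 s0h hT => /(le_trans (ler_norm _)).
  by rewrite (addrC s0) addrK; nra.
pose h := Num.min h0 (t - s0).
have hp : 0 < h by rewrite lt_min h0p subr_gt0.
have s0ht : s0 + h <= t by rewrite -lerBrDl ge_min lexx orbT.
have : S (s0 + h).
  split=> //; first by rewrite addr_ge0// ltW.
  by apply: hg; rewrite // ?ge_min ?lexx// (le_trans s0ht).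
by move/(sup_upper_bound hS); rewrite gerDl leNgt hp.
Qed.

End Trajectories.

(** * Weighted Lyapunov estimate for a perturbed system *)

Section Lyapunov.
Context {R : realType}.

Lemma expRN_ge (x y : R) : expR (- x) * (1 - (y - x)) <= expR (- y).
Proof.
have -> : - y = - x + - (y - x) by ring.
by rewrite expRD ler_wpM2l ?expR_ge0// expR_ge1Dx.
Qed.

Lemma expRN_dist (x y : R) : 0 <= x -> x <= y -> `|expR (- y) - expR (- x)| <= y - x.
Proof.
move=> x0 xy; have yx : expR (- y) <= expR (- x) by rewrite ler_expR lerN2.
rewrite ler0_norm ?subr_le0// opprB.
have := expRN_ge x y; have : expR (- x) <= 1 by rewrite -expR0 ler_expR oppr_le0.
by have := expR_ge0 (- x); nra.
Qed.

Lemma qformD n (P : 'M[R]_n) a b : P^T = P ->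
  qform P (a + b) = qform P a + 2 * bform P a b + qform P b.
Proof.
move=> sP; rewrite /qform -!/(bform _ _ _) !bformDl !bformDr (bformC b a sP).
by ring.
Qed.

(** [V] along [z] is compared with the barrier [b0 ^+ 2 * E s ^+ 2], which decays at rate
    [alpha / 2]. At contact [V] has nominal rate [alpha], and the spare half absorbs the
    perturbation once [b0] is at least [m * rho]. The speed bound [k] does not enter [a] and [b]. *)
Lemma lyapunov_weighted_bound n (P : 'M[R]_n) (F : 'cV[R]_n -> 'cV[R]_n) (alpha : R) :
  posdef P -> 0 < alpha -> glob_lipschitz F ->
  (forall z, 2 * bform P z (F z) <= - alpha * qform P z) ->
  exists a b, [/\ 0 <= a, 0 <= b &
    forall (z f : R -> 'cV[R]_n) (T k rho : R),
      carath_sol z f -> 0 <= T -> 0 < rho ->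
      (forall s, 0 <= s -> s <= T -> enorm (f s) <= k) ->
      (forall s, 0 <= s -> s <= T ->
         enorm (f s - F (z s)) <= rho * expR (- (alpha / 4 * s))) ->
      forall t, 0 <= t -> t <= T ->
        enorm (z t) <= (a * enorm (z 0) + b * rho) * expR (- (alpha / 4 * t))].
Proof.
move=> pdP al0 /glob_lipschitz_ge0[L L0 FL] decr.
have [p [q [p0 q0 Pp Pq]]] := posdef_bounds pdP; have [sP pP] := pdP.
have Vge0 z : 0 <= qform P z.
  by have [->|/pP/ltW//] := eqVneq z 0; rewrite /qform mulmx0 mxE.
set N : R := n%:R; have N0 : 0 <= N by rewrite ler0n.
(* Chosen so that the decrease margin [X] below is strictly positive. *)
pose m := 4 * p * q * N / alpha + 1.
have m1 : 4 * p * q * N < m * alpha.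
  have -> : m * alpha = 4 * p * q * N + alpha by rewrite /m; field; rewrite gt_eqF.
  by rewrite ltrDl.
have m0 : 0 < m.
  by rewrite -(pmulr_lgt0 _ al0); apply: le_lt_trans m1; rewrite !mulr_ge0.
exists (q * (p + 1)), (q * m).
split; [by rewrite mulr_ge0// addr_ge0|by rewrite mulr_ge0// ltW|].
move=> z f T k rho zf T0 rho0 fk fF t t0 tT.
have k0 : 0 <= k by apply: le_trans (fk 0 _ _) => //; exact: enorm_ge0.
(* The first summand puts the initial value below the barrier, [p + 1] standing in for the square
   root of [p]; the second dominates the perturbation. *)
set b0 := (p + 1) * enorm (z 0) + m * rho.
have z00 := enorm_ge0 (z 0).
have b1 : m * rho <= b0 by rewrite lerDr mulr_ge0// addr_ge0.
have b0p : 0 < b0 by apply: lt_le_trans b1; rewrite mulr_gt0.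
pose E s := expR (- (alpha / 4 * s)).
have E0 s : 0 < E s by exact: expR_gt0.
have EE s : E s ^+ 2 = expR (- (alpha / 2 * s)).
  by rewrite expr2 -expRD; congr expR; field.
have Elt s r : s <= r -> E r <= E s.
  by move=> sr; rewrite ler_expR lerN2 ler_wpM2l// divr_ge0// ltW.
have dz s r : 0 <= s -> s <= r -> r <= T -> enorm (z r - z s) <= N * ((r - s) * k).
  move=> s0 sr rT; apply: (carath_lipschitz zf) => // u su ur.
  by rewrite fk ?(le_trans s0)// (le_trans ur).
pose g s := qform P (z s) - b0 ^+ 2 * E s ^+ 2.
have zV s c : 0 <= c -> qform P (z s) <= c ^+ 2 -> enorm (z s) <= q * c.
  move=> c0 Vc; rewrite -(@ler_pXn2r _ 2)// ?nnegrE ?enorm_ge0 ?mulr_ge0//.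
  by rewrite (le_trans (Pq _))// exprMn ler_wpM2l// sqr_ge0.
suff gt0 : g t <= 0.
  rewrite -/(E t) -!mulrA -mulrDr -/b0 -mulrA zV ?mulr_ge0 ?(ltW b0p) ?(ltW (E0 t))//.
  by rewrite exprMn -subr_le0.
have [M M0 zM] := carath_bounded zf T0.
apply: (@lipschitz_barrier _ g T (2 * p * N * k * M + b0 ^+ 2 * (alpha / 2))) => //.
- move=> s r s0 sr rT; have rs0 : 0 <= r - s by rewrite subr_ge0.
  have r0 : 0 <= r by exact: le_trans sr.
  have sT : s <= T by exact: le_trans rT.
  have -> : g r - g s = bform P (z r - z s) (z r) + bform P (z s) (z r - z s)
      - b0 ^+ 2 * (E r ^+ 2 - E s ^+ 2).
    rewrite /g /qform -!/(bform _ _ _) -(scaleN1r (z s)) bformDl bformDr bformZl bformZr.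
    ring.
  have h1 a b u : enorm a <= M -> enorm b <= N * ((r - s) * k) ->
      u = bform P a b \/ u = bform P b a -> `|u| <= p * N * k * M * (r - s).
    move=> aM bk [->|->]; rewrite ?(bformC b a sP); apply: le_trans (Pp _ _) _;
    rewrite (_ : _ * (r - s) = p * M * (N * ((r - s) * k))); try ring;
    by apply: ler_pM; rewrite ?mulr_ge0 ?enorm_ge0// ler_wpM2l.
  have h2 := h1 (z r) (z r - z s) _ (zM r r0 rT) (dz s r s0 sr rT) (or_intror erefl).
  have h3 := h1 (z s) (z r - z s) _ (zM s s0 sT) (dz s r s0 sr rT) (or_introl erefl).
  have h4 : `|b0 ^+ 2 * (E r ^+ 2 - E s ^+ 2)| <= b0 ^+ 2 * (alpha / 2) * (r - s).
    rewrite normrM ger0_norm ?sqr_ge0// -mulrA ler_wpM2l ?sqr_ge0// !EE mulrBr.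
    by apply: expRN_dist; rewrite ?mulr_ge0 ?ler_wpM2l ?divr_ge0// ltW.
  apply: le_trans (ler_normB _ _) _; apply: le_trans (lerD (ler_normD _ _) (lexx _)) _.
  by move: h2 h3 h4; do 3 move: `|_|; move=> x1 x2 x3; lra.
- rewrite /g EE mulr0 oppr0 expR0 mulr1 subr_le0.
  apply: le_trans (_ : ((p + 1) * enorm (z 0)) ^+ 2 <= _).
    apply: le_trans (ler_norm _) (le_trans (Pp _ _) _).
    by have := mulr_ge0 z00 z00; have := sqr_ge0 p; nra.
  have p1z : 0 <= (p + 1) * enorm (z 0) by rewrite mulr_ge0// addr_ge0.
  rewrite ler_pXn2r ?nnegrE ?p1z ?(ltW b0p)//.
  by rewrite lerDl mulr_ge0// ltW.
- move=> s s0 sT gs.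
  have Vs : qform P (z s) = b0 ^+ 2 * E s ^+ 2 by apply/eqP; rewrite -subr_eq0 -/(g s) gs.
  have zs : enorm (z s) <= q * (b0 * E s).
    by rewrite zV ?mulr_ge0 ?(ltW b0p) ?(ltW (E0 s))// Vs exprMn.
  (* [X] is the guaranteed first-order rate of decrease of [g] at a contact time, and [K] collects
     the coefficients of [h ^+ 2]; for [h] up to [X / (K + 1)] the first-order term wins. *)
  pose X := E s ^+ 2 * b0 * (alpha / 2 * b0 - 2 * p * q * N * rho).
  have X0 : 0 < X.
    by rewrite !mulr_gt0 ?exprn_gt0//; nra.
  pose K := 2 * p * q * b0 * E s * N * L * N * k + p * (N * k) ^+ 2.
  have K0 : 0 <= K.
    by rewrite addr_ge0 ?mulr_ge0 ?sqr_ge0 ?(ltW b0p) ?(ltW (E0 s)).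
  have K1 : 0 < K + 1 by rewrite ltr_wpDl.
  exists (X / (K + 1)) => [|h h0]; first by rewrite divr_gt0.
  rewrite ler_pdivlMr// => hX shT.
  have ssh : s <= s + h by rewrite lerDl ltW.
  have shs : s + h - s = h by rewrite addrAC subrr add0r.
  set D := z (s + h) - z s.
  have Dk : enorm D <= N * (h * k).
    by have := dz s (s + h) s0 ssh shT; rewrite shs.
  (* The defect of an Euler step: it comes from the perturbation, of size [rho * E s], and from the
     drift of [F] along [z] during the step. *)
  set Q := D - h *: F (z s).
  have Qk : enorm Q <= N * (h * (rho * E s + L * (N * (h * k)))).
    have := @carath_increment _ _ z f s (s + h) (rho * E s + L * (N * (h * k)))
      (F (z s)) zf s0 ssh.
    rewrite shs -/D; apply.
      by rewrite addr_ge0 ?mulr_ge0 ?(ltW rho0) ?(ltW (E0 s)) ?(ltW h0).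
    move=> r sr rs; have r0 := le_trans s0 sr.
    have rT : r <= T by exact: le_trans rs shT.
    have -> : f r - F (z s) = (f r - F (z r)) + (F (z r) - F (z s)).
      by rewrite addrA subrK.
    apply: le_trans (ler_enormD _ _) _; apply: lerD.
      by apply: le_trans (fF r r0 rT) _; rewrite ler_wpM2l ?(ltW rho0)// Elt.
    apply: le_trans (FL _ _) _; rewrite ler_wpM2l//.
    apply: le_trans (dz s r s0 sr rT) _; rewrite ler_wpM2l// ler_wpM2r//.
    by rewrite -shs lerD2r.
  have VE : qform P (z (s + h)) = qform P (z s) + h * (2 * bform P (z s) (F (z s)))
      + 2 * bform P (z s) Q + qform P D.
    have -> : z (s + h) = z s + D by rewrite /D (addrC (z s)) subrK.
    rewrite (qformD _ _ sP).
    have -> : bform P (z s) D = h * bform P (z s) (F (z s)) + bform P (z s) Q.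
      by rewrite -bformZr -bformDr /Q (addrC (h *: _)) subrK.
    by ring.
  have t1 : 2 * bform P (z s) (F (z s)) <= - alpha * (b0 ^+ 2 * E s ^+ 2).
    by rewrite -Vs.
  have t2 : bform P (z s) Q <=
      p * (q * (b0 * E s)) * (N * (h * (rho * E s + L * (N * (h * k))))).
    apply: le_trans (ler_norm _) (le_trans (Pp _ _) _).
    by apply: ler_pM; rewrite ?mulr_ge0 ?enorm_ge0// ler_wpM2l.
  have t3 : qform P D <= p * (N * (h * k)) * (N * (h * k)).
    apply: le_trans (ler_norm _) (le_trans (Pp _ _) _).
    by apply: ler_pM; rewrite ?mulr_ge0 ?enorm_ge0// ler_wpM2l.
  (* The exponential lies above its tangent, so the barrier cannot fall faster than its initial
     slope. *)
  have t4 : E s ^+ 2 * (1 - alpha / 2 * h) <= E (s + h) ^+ 2.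
    rewrite !EE (_ : alpha / 2 * h = alpha / 2 * (s + h) - alpha / 2 * s); last by ring.
    exact: expRN_ge.
  have {}t4 : b0 ^+ 2 * (E s ^+ 2 * (1 - alpha / 2 * h)) <= b0 ^+ 2 * E (s + h) ^+ 2.
    by rewrite ler_wpM2l ?sqr_ge0.
  have {}t1 := ler_wpM2l (ltW h0) t1.
  rewrite /g subr_le0 VE Vs; apply: le_trans t4.
  have hK : h * (h * K) <= h * X.
    rewrite ler_wpM2l ?(ltW h0)//; apply: le_trans hX.
    by rewrite ler_wpM2l ?(ltW h0)// lerDl.
  move: t1 t2 t3 hK; rewrite /K /X.
  move: (bform _ _ (F _)) (bform _ _ Q) (qform _ D) => y1 y2 y3.
  move: (E s) => e; clear; nra.
Qed.

End Lyapunov.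

(** * Weighted sampling errors and the small-gain argument *)

Section SmallGain.
Context {R : realType}.

(** The implication is applied to the supremum itself, which is finite by the a priori bound. *)
Lemma halving_bound (g : R -> R) (T a : R) : 0 <= T ->
  (exists M, forall s, 0 <= s -> s <= T -> g s <= M) ->
  (forall M, (forall s, 0 <= s -> s <= T -> g s <= M) ->
     forall s, 0 <= s -> s <= T -> g s <= M / 2 + a) ->
  forall s, 0 <= s -> s <= T -> g s <= 2 * a.
Proof.
move=> T0 [M gM] half.
pose S := [set g s | s in [set s | 0 <= s /\ s <= T]].
have S0 : S !=set0 by exists (g 0), 0.
have hS : has_sup S by split=> //; exists M => _ [s [s0 sT] <-]; exact: gM.
have gsup s : 0 <= s -> s <= T -> g s <= sup S.
  by move=> s0 sT; apply: sup_upper_bound => //; exists s.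
have : sup S <= sup S / 2 + a.
  by apply: ge_sup => // _ [s [s0 sT] <-]; exact: half.
by move=> h s s0 sT; apply: le_trans (gsup s s0 sT) _; lra.
Qed.

(* Both triggering thresholds use eps = 1. *)
Definition held_error n m (H : 'M[R]_(m, n)) (z : R -> 'cV[R]_n) (tau sig : R)
    (e : R -> 'cV[R]_m) : Prop :=
  forall s, 0 <= s -> exists tk, [/\ 0 <= tk, tk <= s, e s = H *m z tk - H *m z s &
    s < tk + tau \/ enorm (e s) <= sig * enorm (H *m z s) + 1].

(** Within the dwell time the error is [H] applied to an increment of [z] over a time below [tau],
    which gives the first term; after it, the threshold gives the other two, the last one from its
    offset 1. *)
Lemma held_error_weighted n m (H : 'M[R]_(m, n)) (z f : R -> 'cV[R]_n) e
    (tau sig lam h T Q M : R) :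
  carath_sol z f -> held_error H z tau sig e ->
  0 <= tau -> tau <= 1 -> 0 <= sig -> 0 <= lam -> 0 <= h -> 0 <= Q ->
  (forall v, enorm (H *m v) <= h * enorm v) ->
  (forall s, 0 <= s -> s <= T -> expR (lam * s) * enorm (f s) <= Q) ->
  (forall s, 0 <= s -> s <= T -> expR (lam * s) * enorm (z s) <= M) ->
  forall s, 0 <= s -> s <= T -> expR (lam * s) * enorm (e s) <=
    h * n%:R * expR lam * tau * Q + sig * h * M + expR (lam * T).
Proof.
move=> zf He tau0 tau1 sig0 lam0 h0 Q0 Hh fQ zM s s0 sT.
have X0 t : 0 < expR (lam * t) := expR_gt0 _.
have M0 : 0 <= M by apply: le_trans (zM s s0 sT); rewrite mulr_ge0 ?enorm_ge0 ?expR_ge0.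
have n0 : 0 <= n%:R :> R by rewrite ler0n.
have P1 : 0 <= h * n%:R * expR lam * tau * Q by rewrite !mulr_ge0// expR_ge0.
have P2 : 0 <= sig * h * M by rewrite !mulr_ge0.
have [tk [tk0 tks eE [stk|trig]]] := He s s0.
- have fk u : tk <= u -> u <= s -> enorm (f u) <= Q / expR (lam * tk).
    move=> tku us; rewrite ler_pdivlMr// mulrC.
    apply: le_trans (fQ u (le_trans tk0 tku) (le_trans us sT)).
    by rewrite ler_wpM2r ?enorm_ge0// ler_expR ler_wpM2l.
  have dz := carath_lipschitz zf tk0 tks (divr_ge0 Q0 (expR_ge0 _)) fk.
  have st : 0 <= s - tk by rewrite subr_ge0.
  suff : expR (lam * s) * enorm (e s) <= h * n%:R * expR lam * tau * Q.
    by have := ltW (X0 T); lra.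
  apply: (@le_trans _ _ (expR (lam * s) * (h * (n%:R * (tau * (Q / expR (lam * tk))))))).
    rewrite ler_wpM2l ?expR_ge0// eE -mulmxBr (le_trans (Hh _))// ler_wpM2l//.
    rewrite enorm_distC (le_trans dz)// ler_wpM2l// ler_wpM2r ?divr_ge0 ?expR_ge0//.
    by rewrite lerBlDl ltW.
  have -> : expR (lam * s) * (h * (n%:R * (tau * (Q / expR (lam * tk))))) =
      h * n%:R * (expR (lam * s) / expR (lam * tk)) * tau * Q.
    by field; rewrite gt_eqF.
  (* The weights at [s] and [tk] differ by a factor at most [expR lam], because [s - tk] is below
     [tau], hence below 1. *)
  rewrite -expRN -expRD ler_wpM2r// ler_wpM2r// ler_wpM2l ?mulr_ge0// ler_expR.
  have -> : lam * s + - (lam * tk) = lam * (s - tk) by ring.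
  by rewrite ler_piMr// lerBlDl (le_trans (ltW stk))// lerD2l.
- suff : expR (lam * s) * enorm (e s) <= sig * h * M + expR (lam * T) by lra.
  apply: (@le_trans _ _ (expR (lam * s) * (sig * (h * enorm (z s)) + 1))).
    rewrite ler_wpM2l ?expR_ge0//; apply: le_trans trig _.
    by rewrite lerD2r ler_wpM2l.
  rewrite mulrDr mulr1 lerD ?ler_expR ?ler_wpM2l//.
  rewrite (_ : _ * _ = sig * h * (expR (lam * s) * enorm (z s))); last by ring.
  by rewrite ler_wpM2l ?mulr_ge0// zM.
Qed.

(* The halved quantity is the weighted supremum of |z| + k (|e1| + |e2|): a large
   k absorbs the Lyapunov gain from the errors to z, small tau and sig the rest. *)
Lemma sampled_data_ISpS n m1 m2 (P : 'M[R]_n) (F : 'cV[R]_n -> 'cV[R]_n)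
    (alpha c : R) (H1 : 'M[R]_(m1, n)) (H2 : 'M[R]_(m2, n)) :
  posdef P -> 0 < alpha -> glob_lipschitz F -> F 0 = 0 -> 0 <= c ->
  (forall z, 2 * bform P z (F z) <= - alpha * qform P z) ->
  exists tau sig a b, [/\ 0 < tau /\ 0 < sig, 0 <= a, 0 <= b &
    forall (z f : R -> 'cV[R]_n) e1 e2 (W : R),
      carath_sol z f -> 0 <= W ->
      held_error H1 z tau sig e1 -> held_error H2 z tau sig e2 ->
      (forall s, 0 <= s ->
         enorm (f s - F (z s)) <= c * (enorm (e1 s) + enorm (e2 s) + W)) ->
      forall T, 0 <= T ->
        enorm (z T) <= a * enorm (z 0) * expR (- (alpha / 4 * T)) + b * (W + 1)].
Proof.
move=> pdP al0 FL F0 c0 decr.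
have [a0 [b0 [a0p b0p lyap]]] := lyapunov_weighted_bound pdP al0 FL decr.
have [L L0 FLz] := glob_lipschitz_ge0 FL.
have [h1 h10 Hh1] := mulmx_enorm_bound H1; have [h2 h20 Hh2] := mulmx_enorm_bound H2.
pose h := h1 + h2; have h0 : 0 <= h by rewrite addr_ge0.
have {}Hh1 v : enorm (H1 *m v) <= h * enorm v.
  by rewrite (le_trans (Hh1 v))// ler_wpM2r ?enorm_ge0// lerDl.
have {}Hh2 v : enorm (H2 *m v) <= h * enorm v.
  by rewrite (le_trans (Hh2 v))// ler_wpM2r ?enorm_ge0// lerDr.
pose lam := alpha / 4; have lam0 : 0 <= lam by rewrite divr_ge0// ltW.
(* Makes the Lyapunov contribution [b0 * c * (M / k)] at most [M / 4]. *)
have [k k0 kbc] : exists2 k, 0 < k & 4 * b0 * c <= k.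
  by exists (4 * b0 * c + 1); rewrite ?ltr_wpDl ?lerDl// !mulr_ge0.
pose G := h * n%:R * expR lam; have G0 : 0 <= G by rewrite !mulr_ge0 ?expR_ge0.
(* With [r1 * tau] and [r2 * sig] at most 1, each of the two errors contributes [M / 16] through
   [tau] and [M / 16] through [sig]. Together with the Lyapunov part this totals [M / 2]. *)
pose r1 := 16 * k * (G * (L + c / k)).
have ck0 : 0 <= c / k by rewrite divr_ge0// ltW.
have r10 : 0 <= r1.
  by rewrite mulr_ge0 ?(mulr_ge0 _ (ltW k0))// (mulr_ge0 G0)// addr_ge0.
pose r2 := 16 * k * h; have r20 : 0 <= r2 by rewrite !mulr_ge0 ?(ltW k0).
pose tau := (1 + r1)^-1; pose sig := (1 + r2)^-1.
have r11 : 0 < 1 + r1 by rewrite ltr_wpDr.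
have r21 : 0 < 1 + r2 by rewrite ltr_wpDr.
have tau0 : 0 < tau by rewrite invr_gt0.
have sig0 : 0 < sig by rewrite invr_gt0.
have tau1 : tau <= 1 by rewrite invf_le1// lerDl.
have taur : r1 * tau <= 1 by rewrite ler_pdivrMr// mul1r lerDr.
have sigr : r2 * sig <= 1 by rewrite ler_pdivrMr// mul1r lerDr.
(* The coefficient of [Y]: [b0 * (c + 1)] from the Lyapunov estimate and [k * (G * c + 1)] from each
   sampling error. *)
pose D := b0 * (c + 1) + 2 * k * (G * c + 1).
have D0 : 0 <= D.
  by rewrite addr_ge0// mulr_ge0 ?addr_ge0 ?mulr_ge0 ?(ltW k0).
exists tau, sig, (2 * a0), (2 * D); split; rewrite ?mulr_ge0//.
move=> z f e1 e2 W zf W0 He1 He2 fF T T0.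
pose X s := expR (lam * s); have X0 s : 0 < X s by exact: expR_gt0.
have XT s : s <= T -> X s <= X T by move=> sT; rewrite ler_expR ler_wpM2l.
have Xinv s : expR (- (alpha / 4 * s)) = (X s)^-1 by rewrite expRN.
pose g s := X s * (enorm (z s) + k * (enorm (e1 s) + enorm (e2 s))).
(* Dominates both the weighted disturbance and the weighted threshold offset. *)
pose Y := X T * (W + 1).
have W10 : 0 < W + 1 by rewrite ltr_wpDl.
have Y0 : 0 < Y by rewrite mulr_gt0.
suff : g T <= 2 * (a0 * enorm (z 0) + D * Y).
  move=> gT; have : X T * enorm (z T) <= 2 * (a0 * enorm (z 0) + D * Y).
    apply: le_trans gT; rewrite ler_wpM2l ?(ltW (X0 T))// lerDl.
    by rewrite mulr_ge0 ?addr_ge0 ?enorm_ge0 ?(ltW k0).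
  rewrite mulrC -ler_pdivlMr// => /le_trans; apply; rewrite Xinv /Y le_eqVlt.
  by apply/orP; left; apply/eqP; field; rewrite gt_eqF.
have [Mz Mz0 zM] := carath_bounded zf T0.
apply: (@halving_bound g T) => //.
  (* The a priori bound: each error is a difference of two values of [H *m z], and [z] is bounded on
     the interval. *)
  exists (X T * (Mz + k * (2 * h * Mz + 2 * h * Mz))) => s s0 sT.
  have eb m (H : 'M[R]_(m, n)) e : held_error H z tau sig e ->
      (forall v, enorm (H *m v) <= h * enorm v) -> enorm (e s) <= 2 * h * Mz.
    move=> He Hh; have [tk [tk0 tks -> _]] := He s s0.
    apply: le_trans (ler_enormB _ _) _.
    have := le_trans (Hh (z tk)) (ler_wpM2l h0 (zM tk tk0 (le_trans tks sT))).
    have := le_trans (Hh (z s)) (ler_wpM2l h0 (zM s s0 sT)).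
    lra.
  have ee1 := eb _ _ _ He1 Hh1; have ee2 := eb _ _ _ He2 Hh2.
  apply: ler_pM; rewrite ?XT ?(ltW (X0 s)) ?addr_ge0
     ?mulr_ge0 ?addr_ge0 ?enorm_ge0 ?(ltW k0)//.
  by rewrite lerD ?zM// ler_wpM2l ?(ltW k0)// lerD.
move=> M gM.
have M0 : 0 <= M.
  apply: le_trans (gM 0 (lexx _) T0).
  by rewrite mulr_ge0 ?(ltW (X0 0))// addr_ge0 ?mulr_ge0 ?addr_ge0 ?enorm_ge0 ?(ltW k0).
have zXM s : 0 <= s -> s <= T -> X s * enorm (z s) <= M.
  move=> s0 sT; apply: le_trans (gM s s0 sT); rewrite ler_wpM2l ?(ltW (X0 s))// lerDl.
  by rewrite mulr_ge0 ?addr_ge0 ?enorm_ge0 ?(ltW k0).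
have eXM s : 0 <= s -> s <= T -> X s * (enorm (e1 s) + enorm (e2 s)) <= M / k.
  move=> s0 sT; rewrite ler_pdivlMr//; apply: le_trans (gM s s0 sT).
  by rewrite -mulrA ler_wpM2l ?(ltW (X0 s))// mulrC lerDr enorm_ge0.
have rXM s : 0 <= s -> s <= T -> X s * enorm (f s - F (z s)) <= c * (M / k) + c * Y.
  move=> s0 sT; apply: le_trans (ler_wpM2l (ltW (X0 s)) (fF s s0)) _.
  rewrite mulrCA -mulrDr ler_wpM2l// mulrDr lerD ?eXM// ler_pM ?XT ?(ltW (X0 s))//.
  by rewrite lerDl.
pose Q := L * M + c * (M / k) + c * Y.
have Mk0 : 0 <= M / k by rewrite divr_ge0// ltW.
have Q0 : 0 <= Q by rewrite !addr_ge0 ?(mulr_ge0 c0) ?(mulr_ge0 L0)// ltW.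
have fXQ s : 0 <= s -> s <= T -> X s * enorm (f s) <= Q.
  move=> s0 sT; have := rXM s s0 sT.
  have /(ler_wpM2l (ltW (X0 s))) : enorm (f s) <= enorm (f s - F (z s)) + L * enorm (z s).
    rewrite -{1}(subrK (F (z s)) (f s)) (le_trans (ler_enormD _ _))// lerD2l.
    by have := FLz (z s) 0; rewrite F0 !subr0.
  have := ler_wpM2l L0 (zXM s s0 sT); rewrite /Q; lra.
have hw1 := held_error_weighted zf He1 (ltW tau0) tau1 (ltW sig0) lam0 h0 Q0 Hh1 fXQ zXM.
have hw2 := held_error_weighted zf He2 (ltW tau0) tau1 (ltW sig0) lam0 h0 Q0 Hh2 fXQ zXM.
(* Using [c + 1] keeps [rho] positive even if [c] and [M] vanish. *)
pose rho := c * (M / k) + (c + 1) * Y.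
have rho0 : 0 < rho by rewrite ltr_wpDl ?(mulr_ge0 c0)// mulr_gt0// ltr_wpDl.
have ly := lyap z f T Q rho zf T0 rho0.
move=> s s0 sT; rewrite /g mulrDr mulrCA [X s * (_ + _)]mulrDr.
have z1 : X s * enorm (z s) <= a0 * enorm (z 0) + b0 * rho.
  rewrite mulrC -ler_pdivlMr// -Xinv; apply: ly => // u u0 uT.
    (* The weight is at least 1, so [Q] also bounds [f] unweighted. *)
    apply: le_trans (fXQ u u0 uT); rewrite ler_peMl ?enorm_ge0//.
    by rewrite -expR0 ler_expR mulr_ge0.
  rewrite Xinv ler_pdivlMr// mulrC (le_trans (rXM u u0 uT))// lerD2l.
  by rewrite ler_wpM2r ?(ltW Y0)// lerDl.
have XTY : X T <= Y by rewrite ler_peMr ?(ltW (X0 T))// lerDr.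
have k4 : b0 * (c * (M / k)) <= M / 4.
  rewrite (_ : b0 * (c * (M / k)) = 4 * b0 * c / k * (M / 4)); last first.
    by field; rewrite gt_eqF.
  by rewrite ler_piMl ?divr_ge0// ler_pdivrMr// mul1r.
have tQ : k * (G * tau * Q) <= M / 16 + k * (G * c) * Y.
  have -> : k * (G * tau * Q) = r1 * tau * (M / 16) + tau * (k * (G * c) * Y).
    by rewrite /Q /r1; field; rewrite gt_eqF.
  by rewrite lerD// ler_piMl// ?divr_ge0// !mulr_ge0// ltW.
have sM : k * (sig * h * M) <= M / 16.
  have -> : k * (sig * h * M) = r2 * sig * (M / 16) by rewrite /r2; field.
  by rewrite ler_piMl// divr_ge0.
have := ler_wpM2l (ltW k0) (hw1 s s0 sT); have := ler_wpM2l (ltW k0) (hw2 s s0 sT).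
have := ler_wpM2l (ltW k0) XTY.
rewrite -/(X T) -/(X s) -/G /D.
move: z1 k4 tQ sM; rewrite /rho.
move: (X s * _) (X s * _) (X s * _) => x1 x2 x3; move: (X T) => x4.
clear; move: (M / k) => y; lra.
Qed.

End SmallGain.

(** * Comparison functions and the closed-loop vector field *)

Section ClosedLoop.
Context {R : realType}.

Lemma classK_linear (k : R) : 0 < k -> classK ( *%R k).
Proof.
move=> k0; split; first by rewrite mulr0.
  by apply: continuous_subspaceT => r; exact: mulrl_continuous.
by move=> r s _ rs; rewrite ltr_pM2l.
Qed.

Lemma classKL_expR (k lam : R) : 0 < k -> 0 < lam ->
  classKL (fun r t => k * r * expR (- (lam * t))).
Proof.
move=> k0 lam0; split.
  move=> t t0; have -> : (fun r => k * r * expR (- (lam * t))) =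
      *%R (k * expR (- (lam * t))) by apply/funext => r; rewrite mulrAC.
  by apply: classK_linear; rewrite mulr_gt0// expR_gt0.
move=> r r0; split.
  move=> t s t0 ts; apply: ler_wpM2l; first by rewrite mulr_ge0// ltW.
  by rewrite ler_expR lerN2 ler_wpM2l// ltW.
rewrite -[X in _ --> X](mulr0 (k * r)); apply: cvgMl_tmp.
apply: (@cvg_comp _ _ _ (fun t : R => lam * t) (fun y => expR (- y))); last
  exact: cvgr_expR.
by apply: gt0_cvgMry => //; exact: cvg_id.
Qed.

(** The held signals and the disturbance are independent arguments, so the nominal and the
    event-triggered loops are evaluations of one map. *)
Definition closed_loop_field nx nu ny nq np nw
  (A : 'M[R]_nx) (B : 'M[R]_(nx, nu)) (C : 'M[R]_(ny, nx)) (Cq : 'M[R]_(nq, nx))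
  (E : 'M[R]_(nx, np)) (Ew : 'M[R]_(nx, nw)) (p : 'cV[R]_nq -> 'cV[R]_np)
  (K1 : 'M[R]_(nu, nx)) (K2 : 'M[R]_(nu, np)) (L1 : 'M[R]_(nq, ny)) (L2 : 'M[R]_(nx, ny))
  (x xh : 'cV[R]_nx) (ys : 'cV[R]_ny) (xhs : 'cV[R]_nx) (w : 'cV[R]_nw) : 'cV[R]_(nx + nx) :=
  let u := K1 *m xhs + K2 *m p (Cq *m xhs) in
  let fx := A *m x + B *m u + E *m p (Cq *m x) + Ew *m w in
  let fxh := A *m xh + B *m u + E *m p (Cq *m xh + L1 *m (C *m xh - ys))
             + L2 *m (C *m xh - ys) in
  col_mx fx (fx - fxh).

End ClosedLoop.

(** * The event-triggered loop as a perturbation of the nominal one *)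

Theorem theorem6 (R : realType) (nx nu ny nq np nw : nat)
  (A : 'M[R]_nx) (B : 'M[R]_(nx, nu)) (C : 'M[R]_(ny, nx)) (Cq : 'M[R]_(nq, nx))
  (E : 'M[R]_(nx, np)) (Ew : 'M[R]_(nx, nw)) (p : 'cV[R]_nq -> 'cV[R]_np)
  (omega0 alpha0 mu : R) (P : 'M[R]_(nx + nx))
  (K1 : 'M[R]_(nu, nx)) (K2 : 'M[R]_(nu, np)) (L1 : 'M[R]_(nq, ny)) (L2 : 'M[R]_(nx, ny)) :
  p 0 = 0 ->
  glob_lipschitz p ->
  0 < omega0 ->
  0 < alpha0 -> 0 < mu ->
  posdef P ->
  nominal_decrease A B C Cq E p K1 K2 L1 L2 P alpha0 ->
  exists tauy sigy epsy tauu sigu epsu : R,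
    0 < tauy /\ 0 < sigy /\ 0 < epsy /\ 0 < tauu /\ 0 < sigu /\ 0 < epsu /\
    etc_ISpS A B C Cq E Ew p K1 K2 L1 L2 tauy sigy epsy tauu sigu epsu omega0.
Proof.
move=> p0 pL om0 al0 _ pdP nominal; have [sP _] := pdP.
pose Phi := closed_loop_field A B C Cq E Ew p K1 K2 L1 L2.
(* [v] stacks the state z, the two sampling errors and the disturbance. *)
pose xof (v : 'cV[R]_((nx + nx) + (ny + (nx + nw)))) := usubmx (usubmx v).
pose xhof (v : 'cV[R]_((nx + nx) + (ny + (nx + nw)))) :=
  usubmx (usubmx v) - dsubmx (usubmx v).
pose G v := Phi (xof v) (xhof v) (C *m xof v + usubmx (dsubmx v))
  (xhof v + usubmx (dsubmx (dsubmx v))) (dsubmx (dsubmx (dsubmx v))).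
(* The nominal field is [G] without errors or disturbance, so the perturbation is an increment of
   [G] and is bounded by its Lipschitz constant. *)
pose F z := G (col_mx z 0).
have GE x xh (e1 : 'cV[R]_ny) e2 w :
    G (col_mx (zvec x xh) (col_mx e1 (col_mx e2 w))) = Phi x xh (C *m x + e1) (xh + e2) w.
  by rewrite /G /xof /xhof /zvec !(col_mxKu, col_mxKd) subKr.
have FE x xh : F (zvec x xh) = Phi x xh (C *m x) xh 0.
  by rewrite /F -(@col_mx0 _ ny (nx + nw) 1) -(@col_mx0 _ nx nw 1) GE !addr0.
have zE (z : 'cV[R]_(nx + nx)) : z = zvec (usubmx z) (usubmx z - dsubmx z).
  by rewrite /zvec subKr vsubmxK.
have GL : glob_lipschitz G.
  pose add := @glob_lipschitz_add R; pose opp := @glob_lipschitz_opp R.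
  pose mx := @glob_lipschitz_mulmx R.
  have pcL k f : glob_lipschitz f -> glob_lipschitz (fun v : 'cV[R]_k => p (f v)).
    exact: glob_lipschitz_comp.
  have idL := @glob_lipschitz_id R ((nx + nx) + (ny + (nx + nw))).
  have zL := glob_lipschitz_usub idL; have dL := glob_lipschitz_dsub idL.
  have xL := glob_lipschitz_usub zL.
  have xhL := add _ _ _ _ xL (opp _ _ _ (glob_lipschitz_dsub zL)).
  have ddL := glob_lipschitz_dsub dL; have wL := glob_lipschitz_dsub ddL.
  have ysL := add _ _ _ _ (mx _ _ _ C _ xL) (glob_lipschitz_usub dL).
  have xhsL := add _ _ _ _ xhL (glob_lipschitz_usub ddL).
  have eyL := add _ _ _ _ (mx _ _ _ C _ xhL) (opp _ _ _ ysL).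
  have uL := add _ _ _ _ (mx _ _ _ K1 _ xhsL)
    (mx _ _ _ K2 _ (pcL _ _ (mx _ _ _ Cq _ xhsL))).
  have fxL := add _ _ _ _ (add _ _ _ _ (add _ _ _ _ (mx _ _ _ A _ xL) (mx _ _ _ B _ uL))
    (mx _ _ _ E _ (pcL _ _ (mx _ _ _ Cq _ xL)))) (mx _ _ _ Ew _ wL).
  have fxhL := add _ _ _ _ (add _ _ _ _ (add _ _ _ _ (mx _ _ _ A _ xhL) (mx _ _ _ B _ uL))
    (mx _ _ _ E _ (pcL _ _ (add _ _ _ _ (mx _ _ _ Cq _ xhL) (mx _ _ _ L1 _ eyL)))))
    (mx _ _ _ L2 _ eyL).
  exact: glob_lipschitz_col fxL (add _ _ _ _ fxL (opp _ _ _ fxhL)).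
have FL : glob_lipschitz F.
  apply: (@glob_lipschitz_comp _ _ _ _ G) => //.
  apply: glob_lipschitz_col; first exact: glob_lipschitz_id.
  by exists 0 => a b; rewrite subrr enorm0 mul0r.
have F0 : F 0 = 0.
  rewrite (zE 0) FE /Phi /closed_loop_field !linear0.
  by rewrite !(addr0, subr0, mulmx0, p0, oppr0) /zvec subr0.
have decr z : 2 * bform P z (F z) <= - alpha0 * qform P z.
  rewrite (zE z); move: (usubmx z) (_ - _) => x xh.
  rewrite FE mulrDl mul1r -{1}(bformC _ _ sP).
  have := nominal x xh; rewrite /= /Phi /closed_loop_field /bform mulmx0 addr0.
  exact.
have [Lg Lg0 GLg] := glob_lipschitz_ge0 GL.
(* The two row matrices read the sampled signals off [z]: [C x] for the output, and [xh] as
   [x - (x - xh)]. *)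
have [tau [sig [a [b [[tau0 sig0] a0 b0 bound]]]]] :=
  sampled_data_ISpS (row_mx C 0) (row_mx 1%:M (- 1%:M)) pdP al0 FL F0 Lg0 decr.
exists tau, sig, 1, tau, sig, 1; do 6 (split => //).
(* Adding 1 to the gains makes them positive, as strict monotonicity in class K demands; the offset
   [b] comes from the thresholds. *)
exists (fun r t => (a + 1) * r * expR (- (alpha0 / 4 * t))), ( *%R (b + 1)), b.
split => //.
- by apply: classKL_expR; rewrite ?ltr_wpDl// divr_gt0.
- by apply: classK_linear; rewrite ltr_wpDl.
move=> w x xh ty tu ys xhs _ wom [etmy etmu xsol xhsol] t t0.
(* The bound [omega0] makes [sup] a genuine supremum rather than a default value. *)
have wub s : 0 <= s -> enorm (w s) <= sup_norm w.
  move=> s0; apply: sup_upper_bound; last first.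
    by exists s => //=; rewrite in_itv /= s0.
  split; first by exists (enorm (w 0)), 0 => //=; rewrite in_itv /= lexx.
  by exists omega0 => _ [r /= + <-]; rewrite in_itv /= andbT => /wom.
have W0 : 0 <= sup_norm w := le_trans (enorm_ge0 _) (wub 0 (lexx _)).
have zsol := carath_col xsol (carath_sub xsol xhsol).
have H1E s : row_mx C 0 *m zvec (x s) (xh s) = C *m x s.
  by rewrite mul_row_col mul0mx addr0.
have H2E s : row_mx 1%:M (- 1%:M) *m zvec (x s) (xh s) = xh s.
  by rewrite mul_row_col mulNmx !mul1mx subKr.
have he1 : held_error (row_mx C 0) (fun s => zvec (x s) (xh s)) tau sig
    (fun s => ys s - C *m x s).
  move=> s s0; have [tk [tk0 tks -> trig]] := etm_hold tau0 etmy s0.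
  by exists tk; rewrite !H1E.
have he2 : held_error (row_mx 1%:M (- 1%:M)) (fun s => zvec (x s) (xh s)) tau sig
    (fun s => xhs s - xh s).
  move=> s s0; have [tk [tk0 tks -> trig]] := etm_hold tau0 etmu s0.
  by exists tk; rewrite !H2E.
apply: le_trans (bound _ _ _ _ _ zsol W0 he1 he2 _ t t0) _.
  move=> s s0.
  (* The two arguments of [G] share [z], so their difference consists of the errors and the
     disturbance alone. *)
  have := GLg (col_mx (zvec (x s) (xh s))
      (col_mx (ys s - C *m x s) (col_mx (xhs s - xh s) (w s))))
    (col_mx (zvec (x s) (xh s)) 0).
  rewrite GE 2![_ + (_ - _)]addrC !subrK; move/le_trans; apply; rewrite ler_wpM2l//.
  rewrite opp_col_mx add_col_mx subrr subr0; apply: le_trans (ler_enorm_col _ _) _.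
  rewrite enorm0 add0r -addrA; apply: le_trans (ler_enorm_col _ _) _; rewrite lerD2l.
  by apply: le_trans (ler_enorm_col _ _) _; rewrite lerD2l wub.
rewrite [(a + 1) * _]mulrDl mul1r [(_ + _) * expR _]mulrDl.
have := mulr_ge0 (enorm_ge0 (zvec (x 0) (xh 0))) (expR_ge0 (- (alpha0 / 4 * t))).
rewrite /=; lra.
Qed.
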